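(* Let $\mathcal{U}$ be a properly weakly Ramsey (PWR) ultrafilter on $\mathbb{N}$. For any interval partition $\mathcal{P}=\langle [p_n,p_{n+1})\mid n\in\mathbb{N}\rangle$ of $\mathbb{N}$ without selection set in $\mathcal{U}$, let $A_p^{\mathcal{U}},B_p^{\mathcal{U}},C_p^{\mathcal{U}},E^{\mathcal{U}},S^{\mathcal{U}}$ be the cuts of the ultrapower $\mathbb{N}^{\mathbb{N}}/\mathcal{U}$ whose right parts are generated by $\mathcal{A}_p^{\mathcal{U}},\mathcal{B}_p^{\mathcal{U}},\mathcal{C}_p^{\mathcal{U}},\mathcal{E}^{\mathcal{U}},\mathcal{S}^{\mathcal{U}}$, respectively, and let $F_{\mathcal{U}}$ be the cut of $\mathbb{N}^{\mathbb{N}}/\mathcal{U}$ whose left part is generated by $\mathcal{F}_{\mathcal{U}}$. Then, independently of the chosen interval partition, $$\min\{A_p^{\mathcal{U}},B_p^{\mathcal{U}}\}=S^{\mathcal{U}},\qquad A_p^{\mathcal{U}}=E^{\mathcal{U}},\qquad B_p^{\mathcal{U}}=F_{\mathcal{U}},\qquad C_p^{\mathcal{U}}=\max\{A_p^{\mathcal{U}},B_p^{\mathcal{U}}\}$$ (so that $S^{\mathcal{U}}\le A_p^{\mathcal{U}}=E^{\mathcal{U}}\le C_p^{\mathcal{U}}$ and $S^{\mathcal{U}}\le B_p^{\mathcal{U}}=F_{\mathcal{U}}\le C_p^{\mathcal{U}}$). Moreover, $\mathcal{U}$ is rapid if and only if $\mathbb{N}=F_{\mathcal{U}}$, and then all the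 considered cuts coincide with $\mathbb{N}$.
   Context: All ultrafilters are nonprincipal ultrafilters on $\mathbb{N}$, and all functions are $\mathbb{N}\to\mathbb{N}$. $\mathcal{U}$ is weakly Ramsey (WR) if for every finite colouring of $[\mathbb{N}]^2$ there is $U\in\mathcal{U}$ such that $[U]^2$ has only (i.e. at most) two colours. $\mathcal{U}$ is selective if every function is constant or one-to-one on some set of $\mathcal{U}$; $\mathcal{U}$ is properly weakly Ramsey (PWR) if it is WR but not selective. $\mathcal{U}$ is rapid if for every increasing function $g$ there exists $U=\{u_1<u_2<\dots<u_n<\dots\}\in\mathcal{U}$ such that $u_n>g(n)$ for all $n$. A function is (strictly) increasing, nondecreasing, or one-to-one modulo $\mathcal{U}$ if its restriction to some $U\in\mathcal{U}$ has that property; it is unbounded modulo $\mathcal{U}$ if it is not bounded on any set of $\mathcal{U}$. For $f$ unbounded modulo $\mathcal{U}$, $\mathcal{U}$ is $f$-quasi-selective ($f$-QS) if every $g$ for which there is $U\in\mathcal{U}$ with $g(x)\le f(x)$ for all $x\in U$ is nondecreasing modulo $\mathcal{U}$. An interval partition is a partition of $\mathbb{N}$ into finite intervals $[p_n,p_{n+1})$, with $0=p_0<p_1<p_2<\cdots$. It has no selection set in $\mathcal{U}$ if there is no $U\in\mathcal{U}$ with $|U\cap[p_n,p_{n+1})|\le 1$ for all $n$. For $U\in\mathcal{U}$ and $p_n\le x<p_{n+1}$ put $$a_p^U(x)=|U\cap[p_n,x)|,\quad b_p^U(x)=|U\cap[x,p_{n+1})|,\quad c_p^U(x)=|U\cap[p_n,p_{n+1})|,$$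 and let $\mathcal{A}_p^{\mathcal{U}}=\{a_p^U\mid U\in\mathcal{U}\}$, $\mathcal{B}_p^{\mathcal{U}}=\{b_p^U\mid U\in\mathcal{U}\}$, $\mathcal{C}_p^{\mathcal{U}}=\{c_p^U\mid U\in\mathcal{U}\}$. Also let $\mathcal{E}^{\mathcal{U}}=\{f\mid f$ increasing modulo $\mathcal{U}\}$, $\mathcal{S}^{\mathcal{U}}=\{f\mid f$ one-to-one modulo $\mathcal{U}\}$, $\mathcal{F}_{\mathcal{U}}=\{f\mid \mathcal{U}$ is $f$-QS$\}$. A cut of the linearly ordered ultrapower $\mathbb{N}^{\mathbb{N}}/\mathcal{U}$ is a partition of it into a downward closed left part and an upward closed right part. The cut whose right part (resp. left part) is generated by a family of functions is the one whose right (resp. left) part is the upward (resp. downward) closure of the set of $\mathcal{U}$-equivalence classes of the members of the family. Cuts are ordered by inclusion of their left parts. The cut $\mathbb{N}$ is the one whose left part consists of the classes of the constant functions. If $\mathcal{F}_{\mathcal{U}}$ is empty, then $F_{\mathcal{U}}$ is by convention the cut $\mathbb{N}$. *)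

(* Defs.v *)
From HB Require Import structures.
From mathcomp Require Import all_boot all_order all_classical.

Set Implicit Arguments.
Unset Strict Implicit.
Unset Printing Implicit Defensive.
Import Order.TTheory.

Local Open Scope nat_scope.
Local Open Scope classical_set_scope.
Local Open Scope quotient_scope.

Record nonprincipal_ultrafilter := NonprincipalUltrafilter {
  uset :> set nat -> Prop;
  uset_ultra : UltraFilter uset;
  uset_nonprincipal : forall n, ~ uset [set n]
}.

#[global] Existing Instance uset_ultra.

(* A colouring of [N]^2 is given by its values c x y at the pairs x < y; the
   values of c elsewhere are irrelevant. *)
Definition weakly_Ramsey (U : nonprincipal_ultrafilter) :=
  forall (k : nat) (c : nat -> nat -> 'I_k),
    exists2 A, U A &
      exists2 D : {set 'I_k}, #|D| <= 2 &
        forall x y, A x -> A y -> x < y -> c x y \in D.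

Definition selective (U : nonprincipal_ultrafilter) :=
  forall f : nat -> nat,
    exists2 A, U A & (exists k, forall x, A x -> f x = k) \/ set_inj A f.

Definition properly_weakly_Ramsey (U : nonprincipal_ultrafilter) :=
  weakly_Ramsey U /\ ~ selective U.

(* u 0 < u 1 < ... enumerates the set u_1 < u_2 < ... of U, so u n is u_(n+1). *)
Definition rapid (U : nonprincipal_ultrafilter) :=
  forall g : nat -> nat, {homo g : m n / m < n} ->
    exists u : nat -> nat,
      [/\ {homo u : m n / m < n}, U (range u) & forall n, g n.+1 < u n].

Section Modulo.
Variables (U : nonprincipal_ultrafilter) (f : nat -> nat).

Definition increasing_mod :=
  exists2 A, U A & {in A &, {homo f : x y / x < y}}.

Definition nondecreasing_mod :=
  exists2 A, U A & {in A &, {homo f : x y / x <= y}}.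

Definition one_to_one_mod := exists2 A, U A & set_inj A f.

Definition unbounded_mod :=
  ~ exists2 A, U A & exists k, forall x, A x -> f x <= k.

End Modulo.

Definition quasi_selective (U : nonprincipal_ultrafilter) (f : nat -> nat) :=
  unbounded_mod U f /\
  forall g : nat -> nat,
    (exists2 A, U A & forall x, A x -> g x <= f x) -> nondecreasing_mod U g.

Record interval_partition := IntervalPartition {
  endpoint :> nat -> nat;
  endpoint0 : endpoint 0 = 0;
  endpoint_lt : {homo endpoint : m n / m < n}
}.

Lemma ltn_endpoint (p : interval_partition) (x : nat) : x < p x.+1.
Proof.
by elim: x => [|x IHx]; [rewrite -{1}(endpoint0 p)|apply: leq_ltn_trans IHx _];
  apply: endpoint_lt.
Qed.

Definition block (p : interval_partition) (x : nat) : nat :=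
  ex_minn (ex_intro (fun n => x < p n.+1) x (ltn_endpoint p x)).

Lemma blockP (p : interval_partition) (x : nat) :
  p (block p x) <= x < p (block p x).+1.
Proof.
rewrite /block; case: ex_minnP => -[|n] -> min_n; rewrite andbT.
  by rewrite endpoint0.
by rewrite leqNgt; apply/negP => /min_n; rewrite ltnn.
Qed.

Definition card_itv (A : set nat) (m n : nat) : nat :=
  count (fun y => y \in A) (index_iota m n).

Definition no_selection_set (U : nonprincipal_ultrafilter)
    (p : interval_partition) :=
  ~ exists2 A, U A & forall n, card_itv A (p n) (p n.+1) <= 1.

Definition afun (p : interval_partition) (A : set nat) (x : nat) : nat :=
  card_itv A (p (block p x)) x.
Definition bfun (p : interval_partition) (A : set nat) (x : nat) : nat :=
  card_itv A x (p (block p x).+1).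
Definition cfun (p : interval_partition) (A : set nat) (x : nat) : nat :=
  card_itv A (p (block p x)) (p (block p x).+1).

Section Families.
Variables (U : nonprincipal_ultrafilter) (p : interval_partition).

Definition Afam : set (nat -> nat) := [set afun p A | A in uset U].
Definition Bfam : set (nat -> nat) := [set bfun p A | A in uset U].
Definition Cfam : set (nat -> nat) := [set cfun p A | A in uset U].
Definition Efam : set (nat -> nat) := [set f | increasing_mod U f].
Definition Sfam : set (nat -> nat) := [set f | one_to_one_mod U f].
Definition Ffam : set (nat -> nat) := [set f | quasi_selective U f].

End Families.

Section Ultrapower.
Variable U : nonprincipal_ultrafilter.

Definition ueq (f g : nat -> nat) : bool := `[< U [set x | f x = g x] >].
Definition ule (f g : nat -> nat) : bool := `[< U [set x | f x <= g x] >].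

Lemma ule_refl : reflexive ule.
Proof. by move=> f; apply/asboolP; apply: filterS filterT => x _ /=. Qed.

Lemma ule_trans : transitive ule.
Proof.
move=> g f h /asboolP fg /asboolP gh; apply/asboolP.
by apply: filterS2 fg gh => x /=; exact: leq_trans.
Qed.

Lemma ule_total : total ule.
Proof.
move=> f g; have [fg|gf] := in_ultra_setVsetC [set x | f x <= g x] (uset_ultra U).
  by apply/orP; left; apply/asboolP.
apply/orP; right; apply/asboolP; apply: filterS gf => x /= /negP.
by rewrite -ltnNge => /ltnW.
Qed.

Lemma ueqE f g : ueq f g = ule f g && ule g f.
Proof.
apply/asboolP/andP => [fg|[/asboolP fg /asboolP gf]].
  by split; apply/asboolP; apply: filterS fg => x /= ->.
by apply: filterS2 fg gf => x /= fg gf; apply/eqP; rewrite eqn_leq fg.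
Qed.

Lemma ueq_refl : reflexive ueq.
Proof. by move=> f; rewrite ueqE ule_refl. Qed.

Lemma ueq_sym : symmetric ueq.
Proof. by move=> f g; rewrite !ueqE andbC. Qed.

Lemma ueq_trans : transitive ueq.
Proof.
move=> g f h; rewrite !ueqE => /andP[fg gf] /andP[gh hg].
by rewrite (ule_trans fg gh) (ule_trans hg gf).
Qed.

Canonical ueq_equiv := EquivRel ueq ueq_refl ueq_sym ueq_trans.

Definition ultrapower := {eq_quot ueq}.

HB.instance Definition _ := EqQuotient.on ultrapower.
HB.instance Definition _ := Choice.on ultrapower.

Definition uclass (f : nat -> nat) : ultrapower := \pi_ultrapower f.

Definition ultrapower_le (X Y : ultrapower) : bool := ule (repr X) (repr Y).

Lemma ultrapower_le_refl : reflexive ultrapower_le.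
Proof. by move=> X; exact: ule_refl. Qed.

Lemma ultrapower_le_anti : antisymmetric ultrapower_le.
Proof.
move=> X Y; rewrite /ultrapower_le -ueqE => XY.
by rewrite -(reprK X) -(reprK Y); apply/eqmodP.
Qed.

Lemma ultrapower_le_trans : transitive ultrapower_le.
Proof. by move=> Y X Z; exact: ule_trans. Qed.

Lemma ultrapower_le_total : total ultrapower_le.
Proof. by move=> X Y; exact: ule_total. Qed.

Fact ultrapower_display : Order.disp_t. Proof. exact: Order.Disp tt tt. Qed.

HB.instance Definition _ := Order.Le_isPOrder.Build ultrapower_display ultrapower
  ultrapower_le_refl ultrapower_le_anti ultrapower_le_trans.
HB.instance Definition _ := Order.POrder_isTotal.Build ultrapower_display
  ultrapower ultrapower_le_total.

Lemma uclassE f g : (uclass f == uclass g) = ueq f g.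
Proof. by apply/eqP/idP => [/eqmodP|fg]; last exact/eqmodP. Qed.

Lemma uclass_repr (X : ultrapower) : uclass (repr X) = X.
Proof. exact: reprK. Qed.

Lemma uclass_le f g : (uclass f <= uclass g)%O = ule f g.
Proof.
have E h : ueq h (repr (uclass h)) by rewrite -uclassE uclass_repr.
have := E f; have := E g; rewrite !ueqE => /andP[g1 g2] /andP[f1 f2].
apply/idP/idP => [fg|fg].
  by apply: ule_trans g2; apply: ule_trans f1 _.
exact: ule_trans f2 (ule_trans fg g1).
Qed.

End Ultrapower.

(* The right part of a cut is the complement of its left part, and is then
   automatically upward closed. *)
Record cut {d : Order.disp_t} (T : orderType d) := Cut {
  left_part : set T;
  left_part_down : forall x y : T, (x <= y)%O -> left_part y -> left_part x
}.

Section Cuts.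
Context {d : Order.disp_t} {T : orderType d}.
Implicit Types C D : cut T.

Definition right_part C : set T := ~` left_part C.

Lemma right_part_up C (x y : T) : (x <= y)%O -> right_part C x -> right_part C y.
Proof. by move=> xy Cx /(left_part_down xy). Qed.

HB.instance Definition _ := gen_eqMixin (cut T).
HB.instance Definition _ := gen_choiceMixin (cut T).

Definition cut_le C D : bool := `[< left_part C `<=` left_part D >].

Lemma cut_le_refl : reflexive cut_le.
Proof. by move=> C; apply/asboolP. Qed.

Lemma cut_le_anti : antisymmetric cut_le.
Proof.
move=> [L Ld] [M Md] /andP[/asboolP/= LM /asboolP/= ML].
have E : L = M by rewrite eqEsubset.
by subst M; congr Cut; exact: Prop_irrelevance.
Qed.

Lemma cut_le_trans : transitive cut_le.
Proof.
by move=> D C E /asboolP CD /asboolP DE; apply/asboolP; exact: subset_trans DE.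
Qed.

Lemma cut_le_total : total cut_le.
Proof.
move=> C D; have [CD|/existsNP[x /not_implyP[Cx Dx]]] :=
  pselect (forall x, left_part C x -> left_part D x).
  by apply/orP; left; apply/asboolP.
apply/orP; right; apply/asboolP => y Dy.
have [yx|/ltW xy] := leP y x; first exact: left_part_down Cx.
by case: Dx; exact: left_part_down Dy.
Qed.

Fact cut_display : Order.disp_t. Proof. exact: Order.Disp tt tt. Qed.

HB.instance Definition _ := Order.Le_isPOrder.Build cut_display (cut T)
  cut_le_refl cut_le_anti cut_le_trans.
HB.instance Definition _ := Order.POrder_isTotal.Build cut_display (cut T)
  cut_le_total.

Lemma cut_leE C D : (C <= D)%O = `[< left_part C `<=` left_part D >].
Proof. by []. Qed.

Lemma down_closure_down (G : set T) (x y : T) : (x <= y)%O ->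
  [set z | exists2 g, G g & (z <= g)%O] y ->
  [set z | exists2 g, G g & (z <= g)%O] x.
Proof. by move=> xy [g Gg yg]; exists g => //; exact: le_trans yg. Qed.

Definition cut_left_generated (G : set T) : cut T := Cut (@down_closure_down G).

Lemma up_closureC_down (G : set T) (x y : T) : (x <= y)%O ->
  (~` [set z | exists2 g, G g & (g <= z)%O]) y ->
  (~` [set z | exists2 g, G g & (g <= z)%O]) x.
Proof. by move=> xy Gy [g Gg gx]; apply: Gy; exists g => //; exact: le_trans xy. Qed.

Definition cut_right_generated (G : set T) : cut T := Cut (@up_closureC_down G).

Lemma right_part_generated (G : set T) :
  right_part (cut_right_generated G) = [set z | exists2 g, G g & (g <= z)%O].
Proof. exact: setCK. Qed.

End Cuts.

Section UltrapowerCuts.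
Variable U : nonprincipal_ultrafilter.

Lemma constant_classes_down (X Y : ultrapower U) : (X <= Y)%O ->
  (range (fun k : nat => uclass U (fun=> k))) Y ->
  (range (fun k : nat => uclass U (fun=> k))) X.
Proof.
rewrite -(uclass_repr X); move: (repr X) => f Xk [k _ Yk].
move: Xk; rewrite -{}Yk uclass_le => /asboolP; elim: k => [|k IHk] fk.
  exists 0 => //; apply/eqP; rewrite uclassE ueqE; apply/andP.
  by split; apply/asboolP => //; apply: filterS filterT => x _ /=.
have [eqk|neqk] := in_ultra_setVsetC [set x | f x = k.+1] (uset_ultra U).
  exists k.+1 => //; apply/eqP; rewrite uclassE; apply/asboolP.
  by apply: filterS eqk => x /= ->.
apply: IHk; apply: filterS2 fk neqk => x /= fk /eqP neqk.
by rewrite -ltnS ltn_neqAle neqk.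
Qed.

Definition cutN : cut (ultrapower U) := Cut constant_classes_down.

Definition cutA (p : interval_partition) : cut (ultrapower U) :=
  cut_right_generated (uclass U @` Afam U p).
Definition cutB (p : interval_partition) : cut (ultrapower U) :=
  cut_right_generated (uclass U @` Bfam U p).
Definition cutC (p : interval_partition) : cut (ultrapower U) :=
  cut_right_generated (uclass U @` Cfam U p).
Definition cutE : cut (ultrapower U) :=
  cut_right_generated (uclass U @` Efam U).
Definition cutS : cut (ultrapower U) :=
  cut_right_generated (uclass U @` Sfam U).

(* cutN is the convention for an empty Ffam U, whose downward closure is empty. *)
Definition cutF : cut (ultrapower U) :=
  if `[< Ffam U = set0 >] then cutN
  else cut_left_generated (uclass U @` Ffam U).

End UltrapowerCuts.

(* Main.v *)
Require Import Defs.
From mathcomp Require Import all_boot all_order all_classical.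
From mathcomp Require Import zify.

(** Let p be an interval partition without selection set. Every set of U contains
    two points in the same block and, blocks being finite, two points in distinct
    blocks. Colouring pairs by a given finite colouring together with whether
    the pair lies in one block, weak Ramseyness leaves a set of U with
    one colour for the pairs inside blocks and one for the pairs across blocks
    ([block_homogeneous]). Apply this to the comparison of the values of a function
    f: modulo U, either f is constant, or it is strictly increasing across
    blocks and, inside the blocks, it is uniformly increasing, constant
    or decreasing ([block_monotone]). All the identities between cuts follow from
    this trichotomy.

    The counting function a_p^A is strictly increasing on A inside the blocks, so
    by the trichotomy it is increasing modulo U, while a function increasing on A
    is at least the rank in A and so at least a_p^A: hence A_p = E. Likewise b_p^A
    strictly decreases inside the blocks on A, and every function with that
    property dominates some b_p^B ([decreasing_ge_bfun]). A one-to-one function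
    is of one of these two types, which gives S = min (A_p, B_p); and a function
    fails to be nondecreasing modulo U exactly when it is of the second type,
    which gives B_p = F. Finally c_p^A is the sum of a_p^A and b_p^A, and
    passing to the points of A whose rank in their block has the right parity halves
    it, so C_p = max (A_p, B_p).

    As U is not selective, some partition p without selection set exists
    ([nonselective_partition]). If U is rapid and f is unbounded modulo U, then f is
    finite-to-one on a set of U, and a sufficiently sparse set of U has in the block
    of x at most f x points. So C_p is the cut of the constants, and the
    other cuts lie between S, which is above the constants, and C_p. Conversely, if F
    is the cut of the constants then so is B_q for any coarsening q of p;
    comparing with the function that numbers the blocks of q gives a set
    of U with at most n points in the n-th block, which is sparse once q is coarse
    enough ([cutN_rapid]). *)

Set Implicit Arguments.
Unset Strict Implicit.
Unset Printing Implicit Defensive.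
Import Order.TTheory.

(** * Counting points in intervals *)

Section Counting.
Local Open Scope classical_set_scope.
Implicit Types (A B : set nat) (k l m n x y : nat).

Lemma card_itv_cat A m n k : m <= n -> n <= k ->
  card_itv A m k = card_itv A m n + card_itv A n k.
Proof.
move=> mn nk; rewrite /card_itv -count_cat /index_iota.
have -> : k - m = (n - m) + (k - n) by lia.
by rewrite iotaD subnKC.
Qed.

Lemma card_itv1 A n : card_itv A n n.+1 = (n \in A).
Proof. by rewrite /card_itv /index_iota subSnn /= addn0. Qed.

Lemma card_itvSr A m n : m <= n ->
  card_itv A m n.+1 = card_itv A m n + (n \in A).
Proof. by move=> mn; rewrite (card_itv_cat A mn (leqnSn n)) card_itv1. Qed.

Lemma card_itvSl A m n : m < n ->
  card_itv A m n = (m \in A) + card_itv A m.+1 n.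
Proof. by move=> mn; rewrite (card_itv_cat A (leqnSn m) mn) card_itv1. Qed.

Lemma card_itv_le A m n k : m <= n -> n <= k -> card_itv A m n <= card_itv A m k.
Proof. by move=> mn nk; rewrite (card_itv_cat A mn nk) leq_addr. Qed.

Lemma card_itv_lt A m x y : m <= x -> x < y -> A x ->
  card_itv A m x < card_itv A m y.
Proof.
move=> mx xy Ax; apply: leq_trans (card_itv_le A (leqW mx) xy).
by rewrite card_itvSr // mem_set // addn1.
Qed.

Lemma card_itv_gt A x y n : x < y -> y <= n -> A x ->
  card_itv A y n < card_itv A x n.
Proof.
move=> xy yn Ax; rewrite (card_itv_cat A (ltnW xy) yn) -addn1 addnC leq_add2r.
by rewrite card_itvSl // mem_set.
Qed.

Lemma card_itv_sub A B m n : A `<=` B -> card_itv A m n <= card_itv B m n.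
Proof. by move=> AB; apply: sub_count => x /set_mem/AB/mem_set. Qed.

(** The pigeonhole principle, used to bound the counting functions by a given
    function that separates points. *)
Lemma card_itv_inj A m n k (f : nat -> nat) :
  (forall y, A y -> m <= y -> y < n -> f y < k) ->
  (forall y z, A y -> A z -> m <= y -> y < z -> z < n -> f y <> f z) ->
  card_itv A m n <= k.
Proof.
move=> fk finj; rewrite /card_itv -size_filter -(size_map f) -(size_iota 0 k).
apply: uniq_leq_size.
  rewrite map_inj_in_uniq ?filter_uniq ?iota_uniq// => y z.
  rewrite !mem_filter !mem_index_iota => /andP[/set_mem Ay /andP[my yn]].
  move=> /andP[/set_mem Az /andP[mz zn]] fyz; case: (ltngtP y z) => // yz.
    by case: (finj y z).
  by case: (finj z y).
move=> _ /mapP[y + ->]; rewrite mem_filter mem_index_iota mem_iota.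
by move=> /andP[/set_mem Ay /andP[my yn]]; rewrite /= fk.
Qed.

Lemma card_itv_two A m n x y : m <= x -> x < y -> y < n -> A x -> A y ->
  1 < card_itv A m n.
Proof.
move=> mx xy yn Ax Ay; apply: leq_ltn_trans (card_itv_lt (leq_trans mx (ltnW xy)) yn Ay).
exact: leq_ltn_trans (card_itv_lt mx xy Ax).
Qed.

Lemma card_itv_gt1 A m n : 1 < card_itv A m n ->
  exists x y, [/\ A x, A y, x < y, m <= x & y < n].
Proof.
move=> c; apply: contrapT => nxy; move: c; apply/negP; rewrite -leqNgt.
apply: (@card_itv_inj _ _ _ _ (fun=> 0)) => // y z Ay Az my yz zn _.
by apply: nxy; exists y, z.
Qed.

(** This halves the functions c_p^A: points of odd rank and points of even rank
    alternate in A. The first point has rank 0, so it is for the even ranks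
    that the half is rounded up. *)
Lemma card_itv_parity A (b : bool) m n : m <= n ->
  card_itv [set x | A x /\ odd (card_itv A m x) = b] m n
    = (card_itv A m n + ~~ b)./2.
Proof.
elim: n => [|n IHn] mn; first by (have -> : m = 0 by lia); case: b.
have [->|mn'] : m = n.+1 \/ m <= n by lia.
  by rewrite /card_itv /index_iota subnn; case: b {IHn}.
rewrite !card_itvSr // {}IHn //.
have [An|nAn] := pselect (A n).
  rewrite (mem_set An).
  have [E|E] := eqVneq (odd (card_itv A m n)) b.
    by rewrite mem_set //; case: b E => /=; lia.
  rewrite memNset; first by case: b E => /=; lia.
  by move=> [_ /eqP]; apply/negP.
by rewrite !memNset ?addn0 // => -[].
Qed.

Lemma block_eq (p : interval_partition) x n : p n <= x -> x < p n.+1 ->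
  block p x = n.
Proof.
move=> nx xn; have /andP[bx xb] := blockP p x.
have mono := ltnW_homo (@endpoint_lt p).
case: (ltngtP (block p x) n) => // lt.
  by have := mono _ _ lt; lia.
by have := mono _ _ lt; lia.
Qed.

Lemma block_homo (p : interval_partition) : {homo block p : x y / x <= y}.
Proof.
move=> x y xy; have /andP[bx xb] := blockP p x; have /andP[b_y yb] := blockP p y.
rewrite leqNgt; apply/negP => lt.
by have := ltnW_homo (@endpoint_lt p) lt; lia.
Qed.

Lemma block_lt (p : interval_partition) x y : block p x < block p y -> x < y.
Proof. by move=> lt; rewrite ltnNge; apply/negP => /(block_homo p); lia. Qed.

Lemma lt_block (p : interval_partition) n x : p n.+1 <= x -> n < block p x.
Proof.
move=> nx; rewrite ltnNge; apply/negP => bn; have /andP[_ xb] := blockP p x.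
have : p (block p x).+1 <= p n.+1 by exact: (ltnW_homo (@endpoint_lt p)).
by lia.
Qed.

Lemma increasing_bound (h : nat -> nat) :
  exists2 g, {homo g : m n / m < n} & forall n, h n <= g n.
Proof.
exists (fun n => \sum_(i < n.+1) (h i).+1) => [|n].
  apply: homo_ltn => [y x z|n]; first exact: ltn_trans.
  by rewrite [X in _ < X]big_ord_recr /= addnS ltnS leq_addr.
by rewrite big_ord_recr /= addnS ltnW // ltnS leq_addl.
Qed.

End Counting.

(** * Ultrafilters and the two kinds of pairs *)

Section Pairs.
Local Open Scope classical_set_scope.
Variable U : nonprincipal_ultrafilter.
Implicit Types (A B : set nat) (f g : nat -> nat) (k m n x y : nat).

Lemma bounded_constant f k : U [set x | f x <= k] ->
  exists c, U [set x | f x = c].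
Proof.
elim: k => [|k IHk] fk; first by exists 0; apply: filterS fk => x /=; lia.
have [fE|fE] := in_ultra_setVsetC [set x | f x = k.+1] (uset_ultra U).
  by exists k.+1.
by apply: IHk; apply: filterS2 fk fE => x /=; lia.
Qed.

Lemma tail_set m : U [set x | m < x].
Proof.
have [//|nm] := in_ultra_setVsetC [set x | m < x] (uset_ultra U).
have [|c /uset_nonprincipal //] := @bounded_constant id m.
by apply: filterS nm => x /=; lia.
Qed.

Lemma unbounded_set A m : U A -> exists2 x, A x & m < x.
Proof. by move=> UA; have [x [Ax mx]] := filter_ex (filterI UA (tail_set m)); exists x. Qed.

Lemma unboundedP f : unbounded_mod U f <-> forall k, U [set x | k < f x].
Proof.
split=> [fU k|fU [A UA [k Ak]]].
  have [//|nk] := in_ultra_setVsetC [set x | k < f x] (uset_ultra U).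
  by case: fU; eexists; [exact: nk|exists k => x /=; lia].
by have [x [/Ak + /=]] := filter_ex (filterI UA (fU k)); lia.
Qed.

Variable p : interval_partition.
Hypothesis nosel : no_selection_set U p.

Lemma same_block_pair A : U A ->
  exists x y, [/\ A x, A y, x < y & block p x = block p y].
Proof.
move=> UA; apply: contrapT => nA; apply: nosel; exists A => // n.
rewrite leqNgt; apply/negP => /card_itv_gt1[x [y [Ax Ay xy nx yn]]].
by apply: nA; exists x, y; rewrite !(@block_eq _ _ n) //; lia.
Qed.

Lemma distinct_block_pair A : U A ->
  exists x y, [/\ A x, A y & block p x < block p y].
Proof.
move=> UA; have [x Ax _] := unbounded_set 0 UA.
have [y Ay xy] := unbounded_set (p (block p x).+1) UA.
by exists x, y; split => //; apply: lt_block; exact: ltnW.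
Qed.

Hypothesis wR : weakly_Ramsey U.

(** Let the colour of a pair also record whether its two members share a block. Every set of U
    contains pairs of both kinds, so that a two-coloured set has one colour
    left for each kind. *)
Lemma block_homogeneous (T : finType) (c : nat -> nat -> T) :
  exists2 A, U A & exists i j, forall x y, A x -> A y -> x < y ->
    c x y = if block p x == block p y then i else j.
Proof.
pose d x y := enum_rank (block p x == block p y, c x y).
have [A UA [D D2 dD]] := wR d; exists A => //.
have [x [y [Ax Ay xy bxy]]] := same_block_pair UA.
have [u [v [Au Av buv]]] := distinct_block_pair UA.
have uv := block_lt buv.
have nbuv : (block p u == block p v) = false by lia.
have DE : [set d x y; d u v]%SET = D.
  apply/eqP; rewrite eqEcard finset.subUset !finset.sub1set !dD //= cards2 (leq_trans D2) //.
  by rewrite /d (inj_eq enum_rank_inj) bxy eqxx nbuv.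
exists (c x y), (c u v) => z w Az Aw zw.
have := dD z w Az Aw zw; rewrite -DE !inE /d !(inj_eq enum_rank_inj).
by rewrite bxy eqxx nbuv !xpair_eqE; case: (block p z == _) => /=; rewrite ?orbF => /eqP.
Qed.

Definition in_block (A : set nat) (r : nat -> nat -> Prop) :=
  forall x y, A x -> A y -> x < y -> block p x = block p y -> r x y.

Definition across_blocks (A : set nat) (r : nat -> nat -> Prop) :=
  forall x y, A x -> A y -> block p x < block p y -> r x y.

(** The pairs are coloured by the comparison of the values of f. If f never
    increases across blocks, then its value at one point bounds its values in all
    later blocks, so that f is constant modulo U. *)
Lemma block_monotone f :
  (exists k, U [set x | f x = k]) \/
  exists2 A, U A & across_blocks A (fun x y => f x < f y) /\
    [\/ in_block A (fun x y => f x < f y),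
        in_block A (fun x y => f x = f y) |
        in_block A (fun x y => f y < f x)].
Proof.
have [A UA [[i1 i2] [[j1 j2] cA]]] :=
  block_homogeneous (fun x y => (f x <= f y, f y <= f x)).
have same x y : A x -> A y -> x < y -> block p x = block p y ->
    (f x <= f y) = i1 /\ (f y <= f x) = i2.
  by move=> Ax Ay xy bxy; have := cA x y Ax Ay xy; rewrite bxy eqxx => -[].
have diff x y : A x -> A y -> block p x < block p y ->
    (f x <= f y) = j1 /\ (f y <= f x) = j2.
  move=> Ax Ay bxy; have := cA x y Ax Ay (block_lt bxy).
  by rewrite (ltn_eqF bxy) => -[].
case: j2 diff {cA} => diff.
  left; have [x0 Ax0 _] := unbounded_set 0 UA.
  apply: (@bounded_constant f (f x0)).
  apply: filterS2 UA (tail_set (p (block p x0).+1)) => x Ax /= x0x.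
  by have [_ ->] := diff _ _ Ax0 Ax (lt_block (ltnW x0x)).
right; exists A => //; split.
  by move=> x y Ax Ay bxy; have [] := diff _ _ Ax Ay bxy; lia.
case: i1 i2 same => -[] same.
- by constructor 2 => x y Ax Ay xy bxy; have [] := same _ _ Ax Ay xy bxy; lia.
- by constructor 1 => x y Ax Ay xy bxy; have [] := same _ _ Ax Ay xy bxy; lia.
- by constructor 3 => x y Ax Ay xy bxy; have [] := same _ _ Ax Ay xy bxy; lia.
- by constructor 3 => x y Ax Ay xy bxy; have [] := same _ _ Ax Ay xy bxy; lia.
Qed.

(** * Counting functions of sets in the ultrafilter *)

Lemma in_blockI A B r s : in_block A r -> in_block B s ->
  in_block (A `&` B) (fun x y => r x y /\ s x y).
Proof. by move=> rA sB x y [Ax Bx] [Ay By] xy bxy; split; [exact: rA|exact: sB]. Qed.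

Lemma in_block_absurd A r : U A -> in_block A r -> exists x y, r x y.
Proof.
move=> UA rA; have [x [y [Ax Ay xy bxy]]] := same_block_pair UA.
by exists x, y; exact: rA.
Qed.

Lemma in_block_nonconstant A f k : U A -> in_block A (fun x y => f x <> f y) ->
  ~ U [set x | f x = k].
Proof.
move=> UA fA Uk.
have [x [y [[Ax /= fx] [Ay /= fy] xy bxy]]] := same_block_pair (filterI UA Uk).
by case: (fA x y) => //; rewrite fx fy.
Qed.

Lemma in_block_separated A f : U A -> in_block A (fun x y => f x <> f y) ->
  exists2 B, U B & across_blocks B (fun x y => f x < f y) /\
    (in_block B (fun x y => f x < f y) \/ in_block B (fun x y => f y < f x)).
Proof.
move=> UA fA; have [[k Uk]|[B UB [acr [incr|cst|decr]]]] := block_monotone f.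
- by case: (in_block_nonconstant UA fA Uk).
- by exists B => //; split => //; left.
- have [x [y [+ E]]] := in_block_absurd (filterI UA UB) (in_blockI fA cst).
  by rewrite E.
- by exists B => //; split => //; right.
Qed.

Lemma block_cases A f : across_blocks A (fun x y => f x < f y) ->
  forall x y, A x -> A y -> x < y -> f x < f y \/ block p x = block p y.
Proof.
move=> acr x y Ax Ay xy; have := block_homo p (ltnW xy).
by rewrite leq_eqVlt => /orP[/eqP|/acr]; [right|left; auto].
Qed.

Lemma afun_in_block A : in_block A (fun x y => afun p A x < afun p A y).
Proof.
move=> x y Ax Ay xy bxy; rewrite /afun -bxy.
by apply: card_itv_lt => //; have /andP[] := blockP p x.
Qed.

Lemma bfun_in_block A : in_block A (fun x y => bfun p A y < bfun p A x).
Proof.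
move=> x y Ax Ay xy bxy; rewrite /bfun -bxy.
by apply: card_itv_gt => //; have /andP[_ /ltnW] := blockP p y; rewrite bxy.
Qed.

Lemma afun_increasing A : U A -> increasing_mod U (afun p A).
Proof.
move=> UA; have sep : in_block A (fun x y => afun p A x <> afun p A y).
  by move=> x y Ax Ay xy bxy; have := afun_in_block Ax Ay xy bxy; lia.
have [B UB [acr _]] := in_block_separated UA sep.
exists (A `&` B); first exact: filterI.
move=> x y /set_mem[Ax Bx] /set_mem[Ay By] xy.
by case: (block_cases acr Bx By xy) => // /(afun_in_block Ax Ay xy).
Qed.

Lemma increasing_ge_afun A f x : {in A &, {homo f : x y / x < y}} -> A x ->
  afun p A x <= f x.
Proof.
move=> incr Ax; apply: (card_itv_inj (f := f)) => [y Ay _ yx|y z Ay Az _ yz _].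
  by apply: incr => //; exact: mem_set.
by have := incr _ _ (mem_set Ay) (mem_set Az) yz; lia.
Qed.

(** If f is strictly decreasing inside the blocks and positive on A, then the
    points of A from x to the end of the block of x receive distinct values
    between 1 and f x. The zeros of f can be removed from A because no two of
    them lie in the same block. *)
Lemma decreasing_ge_bfun A f : U A -> in_block A (fun x y => f y < f x) ->
  exists2 B, U B & U [set x | bfun p B x <= f x].
Proof.
move=> UA decr; have Upos : U [set x | 0 < f x].
  have [//|U0] := in_ultra_setVsetC [set x | 0 < f x] (uset_ultra U).
  have [|] := @in_block_nonconstant A f 0 UA.
    by move=> x y Ax Ay xy bxy; have := decr x y Ax Ay xy bxy; lia.
  by apply: filterS U0 => x /=; lia.
have UB : U (A `&` [set x | 0 < f x]) by exact: filterI.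
exists (A `&` [set x | 0 < f x]) => //.
apply: filterS UB => x [Ax /= fx].
have same y : x <= y -> y < p (block p x).+1 -> block p x = block p y.
  move=> xy yb; apply/esym/block_eq => //.
  by have /andP[bx _] := blockP p x; exact: leq_trans xy.
apply: (card_itv_inj (f := fun y => (f y).-1)).
  move=> y [Ay /= fy] xy yb.
  move: xy; rewrite leq_eqVlt => /orP[/eqP <-|xy]; first by lia.
  by have := decr x y Ax Ay xy (same _ (ltnW xy) yb); lia.
move=> y z [Ay /= fy] [Az /= fz] xy yz zb.
have xz := leq_trans xy (ltnW yz); have yb := ltn_trans yz zb.
by have := decr y z Ay Az yz (etrans (esym (same y xy yb)) (same z xz zb)); lia.
Qed.

End Pairs.

(** * Cuts of the ultrapower *)

Section CutTheory.
Local Open Scope classical_set_scope.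
Variable U : nonprincipal_ultrafilter.
Implicit Types (C D : cut (ultrapower U)) (G H : set (nat -> nat)) (f g : nat -> nat).

Lemma le_cutP C D :
  (forall f, left_part C (uclass U f) -> left_part D (uclass U f)) <-> (C <= D)%O.
Proof.
split=> [CD|]; last by rewrite cut_leE => /asboolP CD f; exact: CD.
by rewrite cut_leE; apply/asboolP => X; rewrite -(uclass_repr X); exact: CD.
Qed.

Lemma left_cut_right_generated G f :
  left_part (cut_right_generated (uclass U @` G)) (uclass U f) <->
  ~ exists2 g, G g & U [set x | g x <= f x].
Proof.
split=> nG [].
  move=> g Gg gf; apply: nG; exists (uclass U g); first by exists g.
  by rewrite uclass_le; apply/asboolP.
move=> _ [g Gg <-]; rewrite uclass_le => /asboolP gf.
by apply: nG; exists g.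
Qed.

Lemma le_cut_right_generated G H :
  (forall h, H h -> exists2 g, G g & U [set x | g x <= h x]) ->
  (cut_right_generated (uclass U @` G) <= cut_right_generated (uclass U @` H))%O.
Proof.
move=> GH; apply/le_cutP => f /left_cut_right_generated nG.
apply/left_cut_right_generated => -[h /GH[g Gg gh] hf]; apply: nG; exists g => //.
by apply: filterS2 gh hf => x /=; exact: leq_trans.
Qed.

Lemma left_min C D f : left_part (Order.min C D) (uclass U f) <->
  left_part C (uclass U f) /\ left_part D (uclass U f).
Proof.
by case: leP => [|/ltW] /le_cutP CD; split=> [|[]//] ?; split => //; exact: CD.
Qed.

Lemma left_max C D f : left_part (Order.max C D) (uclass U f) <->
  left_part C (uclass U f) \/ left_part D (uclass U f).
Proof.
by case: leP => [|/ltW] /le_cutP CD; split=> [|[]//]; try (by [left|right]); exact: CD.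
Qed.

Lemma left_cutN f : left_part (cutN U) (uclass U f) <-> ~ unbounded_mod U f.
Proof.
split=> [[k _ /eqP]|/contrapT[A UA [k fk]]].
  rewrite uclassE => /asboolP kf; apply; eexists; first exact: kf.
  by exists k => x /= ->.
have [|c Uc] := @bounded_constant U f k; first exact: filterS UA.
by exists c => //; apply/eqP; rewrite uclassE; apply/asboolP; apply: filterS Uc.
Qed.

(** The functions f for which U is f-quasi-selective are closed downwards among the
    unbounded ones, and bounded functions lie below every unbounded one. When there
    is no such f, the convention on F_U still puts the bounded functions in
    the left part. *)
Lemma left_cutF f : left_part (cutF U) (uclass U f) <->
  ~ unbounded_mod U f \/ quasi_selective U f.
Proof.
rewrite /cutF; case: ifPn => [/asboolP F0|/asboolP/eqP/set0P[g Fg]].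
  rewrite left_cutN; split=> [|[//|Ff]]; first by left.
  by have : Ffam U f by []; rewrite F0.
split=> [[_ [h [hu hq] <-]]|[bf|Ff]].
- rewrite uclass_le => /asboolP fh.
  have [fu|] := pselect (unbounded_mod U f); last by left.
  right; split=> // k [A UA kf]; apply: hq; exists (A `&` [set x | f x <= h x]).
    exact: filterI.
  by move=> x [/kf + /=]; exact: leq_trans.
- move: bf => /contrapT[A UA [k fk]]; exists (uclass U g); first by exists g.
  rewrite uclass_le; apply/asboolP; have [/unboundedP gu _] := Fg.
  by apply: filterS2 UA (gu k) => x /fk + /= => /leq_trans le /ltnW; exact: le.
- by exists (uclass U f) => //; exists f.
Qed.

(** A function bounded modulo U is constant on a set of U, and such a set is
    infinite. *)
Lemma le_cutN_cutS : (cutN U <= cutS U)%O.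
Proof.
apply/le_cutP => f; rewrite left_cutN => bf; apply/left_cut_right_generated.
move=> [g [A UA ginj] gf]; apply: bf => -[B UB [k fk]].
have [|c Uc] := @bounded_constant U g k.
  by apply: filterS2 UB gf => x /fk + /= gfx; exact: leq_trans.
have [x [Ax /= gx] _] := unbounded_set 0 (filterI UA Uc).
have [y [Ay /= gy] xy] := unbounded_set x (filterI UA Uc).
have : x = y by apply: ginj; rewrite ?gx ?gy //; exact: mem_set.
by lia.
Qed.

End CutTheory.

(** * The cuts of an interval partition *)

Section PartitionCuts.
Local Open Scope classical_set_scope.
Variables (U : nonprincipal_ultrafilter) (p : interval_partition).
Hypotheses (nosel : no_selection_set U p) (wR : weakly_Ramsey U).
Implicit Types (A B : set nat) (f g : nat -> nat).

Lemma cutA_cutE : cutA U p = cutE U.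
Proof.
apply/le_anti/andP; split; apply: le_cut_right_generated.
  move=> f [A UA incr]; exists (afun p A); first by exists A.
  by apply: filterS UA => x Ax; exact: increasing_ge_afun.
move=> _ [A UA <-]; exists (afun p A); first exact: afun_increasing.
by apply: filterS filterT => x _ /=.
Qed.

(** Inside the blocks a one-to-one function either increases, and is then increasing
    modulo U, or decreases, and then dominates some b_p^A. *)
Lemma min_cutA_cutB : Order.min (cutA U p) (cutB U p) = cutS U.
Proof.
apply/le_anti/andP; split; apply/le_cutP => f; rewrite left_min.
  rewrite !left_cut_right_generated => -[nA nB] [g [A UA ginj] gf].
  have sep : in_block p A (fun x y => g x <> g y).
    move=> x y Ax Ay xy _ gxy; have := ginj _ _ (mem_set Ax) (mem_set Ay) gxy.
    by lia.
  have [B UB [acr [incr|decr]]] := in_block_separated nosel wR UA sep.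
    apply: nA; exists (afun p B); first by exists B.
    apply: filterS2 UB gf => x Bx /=; apply: leq_trans.
    apply: (@increasing_ge_afun p B) => // y z /set_mem By /set_mem Bz yz.
    by case: (block_cases acr By Bz yz) => // /(incr _ _ By Bz yz).
  have [D UD Dg] := decreasing_ge_bfun nosel UB decr.
  apply: nB; exists (bfun p D); first by exists D.
  by apply: filterS2 Dg gf => x /=; exact: leq_trans.
rewrite !left_cut_right_generated => nS; split=> -[_ [A UA <-] Af]; apply: nS.
  exists (afun p A) => //; have [B UB incr] := afun_increasing nosel wR UA.
  exists B => // x y Bx By E; case: (ltngtP x y) => // xy.
    by have := incr _ _ Bx By xy; rewrite E ltnn.
  by have := incr _ _ By Bx xy; rewrite E ltnn.
exists (bfun p A) => //; have sep : in_block p A (fun x y => bfun p A x <> bfun p A y).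
  by move=> x y Ax Ay xy bxy; have := bfun_in_block Ax Ay xy bxy; lia.
have [B UB [acr _]] := in_block_separated nosel wR UA sep.
exists (A `&` B); first exact: filterI.
have lt x y : A x -> B x -> A y -> B y -> x < y -> bfun p A x <> bfun p A y.
  move=> Ax Bx Ay By xy; case: (block_cases acr Bx By xy) => [|/(sep _ _ Ax Ay xy)//].
  by lia.
move=> x y /set_mem[Ax Bx] /set_mem[Ay By] E; case: (ltngtP x y) => // xy.
  by case: (lt x y).
by case: (lt y x).
Qed.

(** If f lies strictly below all functions b_p^A modulo U, then no function below f
    can decrease inside the blocks, and this is the only way in which a function
    can fail to be nondecreasing modulo U. Conversely b_p^A itself decreases. *)
Lemma cutB_cutF : cutB U p = cutF U.
Proof.
have S_B : (cutS U <= cutB U p)%O by rewrite -min_cutA_cutB ge_min lexx orbT.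
have N_B := le_trans (le_cutN_cutS U) S_B.
apply/le_anti/andP; split; apply/le_cutP => f; rewrite left_cutF.
  rewrite left_cut_right_generated => nB.
  have [fu|] := pselect (unbounded_mod U f); last by left.
  right; split=> // g [D UD gf].
  have [[k Uk]|[A UA [acr mono]]] := block_monotone nosel wR g.
    by eexists; [exact: Uk|move=> x y /set_mem/= -> /set_mem/= -> _].
  exists A => // x y /set_mem Ax /set_mem Ay.
  rewrite leq_eqVlt => /orP[/eqP->//|xy].
  case: (block_cases acr Ax Ay xy) => [/ltnW //|bxy].
  case: mono => mono; try by have := mono _ _ Ax Ay xy bxy; lia.
  have [B UB Bg] := decreasing_ge_bfun nosel UA mono.
  case: nB; exists (bfun p B); first by exists B.
  by apply: filterS2 Bg UD => x' /= le /gf; exact: leq_trans.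
case=> [/left_cutN|[_ fq]]; first by move: f; exact/le_cutP.
apply/left_cut_right_generated => -[_ [A UA <-] Af].
have [B UB nd] := fq (bfun p A) (ex_intro2 _ _ _ Af (fun x => id)).
have [x [y [[Ax Bx] [Ay By] xy bxy]]] := same_block_pair nosel (filterI UA UB).
have := bfun_in_block Ax Ay xy bxy.
by rewrite ltnNge (nd x y (mem_set Bx) (mem_set By)) // ltnW.
Qed.

(** If f dominates a_p^D and b_p^D, then c_p^D, which is their sum, is at most
    2 f. The points of D whose rank inside the block has a given parity make up
    half of D in each block, and one of the two parities gives a set in U. *)
Lemma cutC_max : cutC U p = Order.max (cutA U p) (cutB U p).
Proof.
have split_cfun A x : cfun p A x = afun p A x + bfun p A x.
  by have /andP[? /ltnW ?] := blockP p x; exact: card_itv_cat.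
apply/le_anti/andP; split; last first.
  rewrite ge_max; apply/andP; split; apply: le_cut_right_generated => _ [A UA <-].
    exists (afun p A); first by exists A.
    by apply: filterS filterT => x _ /=; rewrite split_cfun leq_addr.
  exists (bfun p A); first by exists A.
  by apply: filterS filterT => x _ /=; rewrite split_cfun leq_addl.
apply/le_cutP => f; rewrite left_max !left_cut_right_generated => nC.
apply/not_andP => -[[_ [A UA <-] Af] [_ [B UB <-] Bf]]; apply: nC.
pose D := A `&` B; have UD : U D by exact: filterI.
have Df : U [set x | cfun p D x <= (f x).*2].
  apply: filterS2 Af Bf => x /= Af Bf; rewrite split_cfun -addnn leq_add //.
    by apply: leq_trans Af; apply: card_itv_sub => ? [].
  by apply: leq_trans Bf; apply: card_itv_sub => ? [].
have [b Ub] : exists b, U [set x | D x /\ odd (afun p D x) = b].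
  have [Uo|Ue] := in_ultra_setVsetC [set x | odd (afun p D x)] (uset_ultra U).
    by exists true; apply: filterS2 UD Uo => x Dx.
  by exists false; apply: filterS2 UD Ue => x Dx /negP/negbTE.
exists (cfun p [set x | D x /\ odd (afun p D x) = b]); first by eexists; first exact: Ub.
apply: filterS Df => x /= Df.
suff -> : cfun p [set x | D x /\ odd (afun p D x) = b] x = (cfun p D x + ~~ b)./2.
  by case: b {Ub}; lia.
have /andP[bx xb] := blockP p x.
rewrite /cfun -card_itv_parity; last by lia.
apply: eq_in_count => y; rewrite mem_index_iota => /andP[xy yb].
by apply/idP/idP => /set_mem[Dy E]; apply/mem_set; split=> //=; move: E;
  rewrite /afun (block_eq xy yb).
Qed.

End PartitionCuts.

(** * Partitions without selection set *)

Section Partitions.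
Local Open Scope classical_set_scope.
Variable U : nonprincipal_ultrafilter.
Hypothesis wR : weakly_Ramsey U.
Implicit Types (A B : set nat) (f g : nat -> nat) (p : interval_partition).

(** The pairs are coloured by the comparison of the values of f. Pairs of equal
    values occur in every set of U; if decreasing pairs occur too in a set with only
    two colours, then f is nowhere increasing on it, hence bounded, hence
    constant modulo U. *)
Lemma noninjective_nondecreasing f : ~ one_to_one_mod U f -> nondecreasing_mod U f.
Proof.
move=> ninj; pose c x y := enum_rank (f x <= f y, f y <= f x).
have [A UA [D D2 cD]] := wR c.
have [decr|ndecr] := pselect (exists x y, [/\ A x, A y, x < y & f y < f x]); last first.
  exists A => // x y /set_mem Ax /set_mem Ay; rewrite leq_eqVlt => /orP[/eqP->//|xy].
  by rewrite leqNgt; apply/negP => fyx; apply: ndecr; exists x, y.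
have [x [y [Ax Ay xy fyx]]] := decr.
have [z [w [Az Aw zw fzw]]] : exists z w, [/\ A z, A w, z < w & f z = f w].
  apply: contrapT => nzw; apply: ninj; exists A => // z w /set_mem Az /set_mem Aw fzw.
  case: (ltngtP z w) => // zw; case: nzw; first by exists z, w.
  by exists w, z.
have cxy : c x y = enum_rank (false, true) by congr enum_rank; congr pair; lia.
have czw : c z w = enum_rank (true, true) by rewrite /c fzw leqnn.
have DE : [set c x y; c z w]%SET = D.
  apply/eqP; rewrite eqEcard finset.subUset !finset.sub1set !cD //= cards2 (leq_trans D2) //.
  by rewrite cxy czw (inj_eq enum_rank_inj).
have [|k Uk] := @bounded_constant U f (f x).
  apply: filterS2 UA (tail_set U x) => v Av /= xv.
  have := cD x v Ax Av xv; rewrite -DE !inE cxy czw /c !(inj_eq enum_rank_inj).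
  by rewrite !xpair_eqE => /orP[] /andP[_ /eqP].
by exists [set x | f x = k] => // u v /set_mem /= -> /set_mem /= ->.
Qed.

(** Since f is nondecreasing and unbounded on a set A of U, endpoints can be
    placed where f jumps on A. Each fibre of f on A is then contained in one
    block, so that f is injective on the part of A inside a selection set. *)
Lemma nonselective_partition : ~ selective U -> exists p, no_selection_set U p.
Proof.
move=> /existsNP[f nf].
have ninj : ~ one_to_one_mod U f.
  by move=> [A UA finj]; apply: nf; exists A => //; right.
have nconst k : ~ U [set x | f x = k].
  by move=> Uk; apply: nf; eexists; [exact: Uk|left; exists k].
have [A UA nd] := noninjective_nondecreasing ninj.
have mono x y : A x -> A y -> x <= y -> f x <= f y.
  by move=> Ax Ay; apply: nd; exact: mem_set.
have jump m : exists r, m < r /\ forall x y, A x -> A y -> x < r -> r <= y -> f x <> f y.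
  have [x0 Ax0 mx0] := unbounded_set m UA.
  have ex_a : exists a, (a \in A) && (f x0 < f a).
    apply: contrapT => na; have [|k /nconst//] := @bounded_constant U f (f x0).
    apply: filterS UA => x Ax /=; rewrite leqNgt; apply/negP => lt.
    by apply: na; exists x; rewrite lt mem_set.
  (* The first point of A where f exceeds f x0 starts a new fibre of f on A. *)
  case: (ex_minnP ex_a) => r /andP[/set_mem Ar lt] rmin; exists r; split.
    apply: ltn_trans mx0 _; rewrite ltnNge; apply/negP => /(mono _ _ Ar Ax0).
    by lia.
  move=> x y Ax Ay xr ry; have := mono _ _ Ar Ay ry.
  have : ~~ (f x0 < f x).
    by apply/negP => x0x; have := rmin x; rewrite mem_set // x0x => /(_ isT); lia.
  by lia.
have {jump}[next nextP] := choice jump.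
pose q n := iter n next 0.
have q_lt : {homo q : m n / m < n}.
  apply: homo_ltn => [y x z|n]; first exact: ltn_trans.
  by have [] := nextP (q n).
pose p := IntervalPartition (erefl : q 0 = 0) q_lt.
exists p => -[B UB sel]; apply: ninj.
exists (A `&` B); first exact: filterI.
have lt x y : A x -> B x -> A y -> B y -> x < y -> f x <> f y.
  move=> Ax Bx Ay By xy; have /andP[bx xb] := blockP p x.
  have [yb|by_] := ltnP y (p (block p x).+1).
    by have := card_itv_two bx xy yb Bx By; have := sel (block p x); lia.
  by have [_] := nextP (q (block p x)); apply.
move=> x y /set_mem[Ax Bx] /set_mem[Ay By] fxy; case: (ltngtP x y) => // xy.
  by case: (lt x y).
by case: (lt y x).
Qed.

Definition coarsen p (h : nat -> nat) (h0 : h 0 = 0)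
    (h_lt : {homo h : m n / m < n}) : interval_partition :=
  @IntervalPartition (p \o h) (etrans (congr1 p h0) (endpoint0 p))
    (fun m n mn => endpoint_lt p (h_lt m n mn)).

Lemma no_selection_coarsen p h (h0 : h 0 = 0) (h_lt : {homo h : m n / m < n}) :
  no_selection_set U p -> no_selection_set U (coarsen p h0 h_lt).
Proof.
move=> nosel [A UA sel]; apply: nosel; exists A => // n.
set q := coarsen _ _ _ in sel *.
rewrite leqNgt; apply/negP => /card_itv_gt1[x [y [Ax Ay xy nx yn]]].
have /andP[qn nq] := blockP q (p n).
have n_lt : n < h (block q (p n)).+1.
  rewrite ltnNge; apply/negP => /(ltnW_homo (@endpoint_lt p)).
  by move: nq => /=; lia.
have := ltnW_homo (@endpoint_lt p) n_lt => le.
have := sel (block q (p n)); rewrite leqNgt => /negP; apply.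
by apply: (card_itv_two (leq_trans qn nx) xy) => //; exact: leq_trans le.
Qed.

End Partitions.

(** * Rapidity *)

Section Rapid.
Local Open Scope classical_set_scope.
Variables (U : nonprincipal_ultrafilter) (p : interval_partition).
Hypotheses (nosel : no_selection_set U p) (wR : weakly_Ramsey U).
Implicit Types (A B : set nat) (f g u : nat -> nat).

Lemma card_itv_range u m n k : {homo u : i j / i < j} -> n <= u k ->
  card_itv (range u) m n <= k.
Proof.
move=> u_lt nk; pose s y := xget 0 [set i | u i = y].
have sK y : range u y -> u (s y) = y.
  by move=> [i _ uy]; exact: (@xgetPex _ 0 [set i | u i = y] (ex_intro _ i uy)).
apply: (card_itv_inj (f := s)) => [y /sK uy _ yn|y z /sK uy /sK uz _ yz _ syz].
  rewrite ltnNge; apply/negP => /(ltnW_homo u_lt).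
  by rewrite uy; lia.
by move: yz; rewrite -uy -uz syz ltnn.
Qed.

(** Let g n bound the ends of the blocks of the points of A where f is at most n, and
    let u enumerate a set of U growing faster than g. In the block of a point x
    of A this set has at most f x points, since its element u (f x) lies beyond
    that block. *)
Lemma rapid_le_cutN : rapid U -> (cutC U p <= cutN U)%O.
Proof.
move=> rap; apply/le_cutP => f; rewrite left_cut_right_generated left_cutN => nC fu.
apply: nC; have /unboundedP fk := fu.
have [[k Uk]|[A UA [acr _]]] := block_monotone nosel wR f.
  by case: fu; eexists; [exact: Uk|exists k => x /= ->].
have fin n : exists M, forall x, A x -> f x <= n -> p (block p x).+1 <= M.
  have [x0 [Ax0 /= nx0]] := filter_ex (filterI UA (fk n)).
  exists (p (block p x0).+1) => x Ax fx; apply: (ltnW_homo (@endpoint_lt p)).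
  rewrite ltnS leqNgt; apply/negP => /(acr _ _ Ax0 Ax).
  by lia.
have {fin}[M MP] := choice fin.
have [g g_lt Mg] := increasing_bound M.
have [u [u_lt Uu gu]] := rap g g_lt.
exists (cfun p (range u)); first by exists (range u).
apply: filterS UA => x Ax /=; apply: card_itv_range => //.
apply: leq_trans (MP _ _ Ax (leqnn _)) _; apply: leq_trans (Mg _) _.
by apply: ltnW; apply: leq_ltn_trans (gu _); apply: (ltnW_homo g_lt).
Qed.

Lemma enumeration A : U A -> exists u, [/\ {homo u : i j / i < j}, range u = A &
  forall k, card_itv A 0 (u k) = k].
Proof.
move=> UA; have ex_rank k : exists n, A n /\ card_itv A 0 n = k.
  (* The least n below which A has more than k points is the successor of the
     point of rank k. *)
  have exN : exists n, k < card_itv A 0 n.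
    elim: k => [|k [n kn]].
      have [x Ax _] := unbounded_set 0 UA; exists x.+1.
      exact: leq_ltn_trans (card_itv_lt (leq0n x) (ltnSn x) Ax).
    have [x Ax nx] := unbounded_set n UA; exists x.+1.
    have := card_itv_lt (leq0n x) (ltnSn x) Ax.
    by have := card_itv_le A (leq0n n) (ltnW nx); lia.
  case: (ex_minnP exN) => -[|n] kn nmin; first by [].
  have nk : card_itv A 0 n <= k by rewrite leqNgt; apply/negP => /nmin; lia.
  exists n; move: kn; rewrite card_itvSr //; case: (boolP (n \in A)) => [/set_mem|] An /=.
    by split=> //; lia.
  by lia.
have {ex_rank}[u uP] := choice ex_rank.
have lt x y : A x -> x < y -> card_itv A 0 x < card_itv A 0 y.
  by move=> Ax xy; exact: card_itv_lt.
exists u; split=> [i j ij||k]; last by have [] := uP k.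
  have [[Ai ri] [Aj rj]] := (uP i, uP j); case: (ltngtP (u i) (u j)) => // [ji|E].
    by have := lt _ _ Aj ji; lia.
  by have := congr1 (card_itv A 0) E; lia.
rewrite eqEsubset; split=> [_ [k _ <-]|x Ax]; first by have [] := uP k.
exists (card_itv A 0 x) => //; have [Au ru] := uP (card_itv A 0 x).
case: (ltngtP (u (card_itv A 0 x)) x) => // [l|l].
  by have := lt _ _ Au l; lia.
by have := lt _ _ Ax l; lia.
Qed.

(** Pass to a coarser partition q, growing fast enough. The function sending x
    to the number of its q-block is unbounded, so above some b_q^A, which
    means that some set of U has at most n points in the n-th block. Its enumeration
    outgrows g. *)
Lemma cutN_rapid : cutN U = cutF U -> rapid U.
Proof.
(* The n-th endpoint of q has to exceed g (n * n), as A will have at most n * n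
   points in the blocks numbered 0 to n. Adding n makes this strict, and h 0 < h 1. *)
move=> NF g g_lt; pose h n := if n is 0 then 0 else g (n * n) + n.
have h_lt : {homo h : m n / m < n}.
  apply: homo_ltn => [y x z|[|n]]; first exact: ltn_trans.
    by rewrite /h addn1.
  have /(ltnW_homo g_lt) : n.+1 * n.+1 <= n.+2 * n.+2 by nia.
  by rewrite /h; lia.
have noselq := @no_selection_coarsen U p h erefl h_lt nosel.
set q := coarsen _ _ _ in noselq.
have : ~ left_part (cutB U q) (uclass U (block q)).
  rewrite cutB_cutF // -NF left_cutN => /contrapT[A UA [k Ak]].
  have [x Ax kx] := unbounded_set (q k.+1) UA.
  by have := Ak x Ax; have := lt_block (ltnW kx); lia.
rewrite left_cut_right_generated => /contrapT[_ [A0 UA0 <-] A0b].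
set A := A0 `&` [set x | bfun q A0 x <= block q x].
have UA : U A by exact: filterI.
have Ab x : A x -> bfun q A x <= block q x.
  by move=> [_ /=]; apply: leq_trans; apply: card_itv_sub => ? [].
have bpos x : A x -> 0 < bfun q A x.
  move=> Ax; have /andP[_ xb] := blockP q x.
  by rewrite /bfun card_itvSl // mem_set.
have block_card n : card_itv A (q n) (q n.+1) <= n.
  (* b_q^A separates the points of a block and takes values from 1 to n there. *)
  apply: (card_itv_inj (f := fun y => (bfun q A y).-1)).
    move=> y Ay ny yn; have := Ab y Ay; have := bpos y Ay.
    by rewrite (block_eq ny yn); lia.
  move=> y z Ay Az ny yz zn; have := bpos z Az.
  have yn := ltn_trans yz zn; have nz := leq_trans ny (ltnW yz).
  have := bfun_in_block (p := q) Ay Az yz; rewrite (block_eq ny yn) (block_eq nz zn).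
  by move=> /(_ erefl); lia.
have card_le n : card_itv A 0 (q n.+1) <= n * n.
  elim: n => [|n IHn]; first by have := block_card 0; rewrite endpoint0.
  rewrite (@card_itv_cat A 0 (q n.+1)) //; last exact: ltnW (endpoint_lt _ _).
  by have := block_card n.+1; nia.
have [u [u_lt uA rank]] := enumeration UA.
exists u; split=> //; first by rewrite uA.
move=> k; set n := block q (u k).
have Auk : A (u k) by rewrite -uA; exists k.
have /andP[nu un] : q n <= u k < q n.+1 := blockP q (u k).
have kn : k < n * n.
  by rewrite -[X in X < _](rank k); apply: leq_trans (card_le n); exact: card_itv_lt.
apply: leq_trans nu; case: n kn {un} => // n kn.
rewrite /q /=; apply: leq_ltn_trans (ltnW_homo g_lt kn) _.
by rewrite addnS; apply: leq_ltn_trans (ltn_endpoint p _); rewrite leq_addr.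
Qed.

End Rapid.

Theorem theorem2p3 (U : nonprincipal_ultrafilter)
    (U_pwr : properly_weakly_Ramsey U) :
  (forall p : interval_partition, no_selection_set U p ->
     [/\ Order.min (cutA U p) (cutB U p) = cutS U,
         cutA U p = cutE U,
         cutB U p = cutF U &
         cutC U p = Order.max (cutA U p) (cutB U p)] /\
     [/\ (cutS U <= cutA U p)%O, (cutA U p <= cutC U p)%O,
         (cutS U <= cutB U p)%O & (cutB U p <= cutC U p)%O]) /\
  (rapid U <-> cutN U = cutF U) /\
  (rapid U ->
     [/\ cutS U = cutN U, cutE U = cutN U, cutF U = cutN U &
         forall p : interval_partition, no_selection_set U p ->
           [/\ cutA U p = cutN U, cutB U p = cutN U & cutC U p = cutN U]]).
Proof.
have [wR nsel] := U_pwr.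
have order p : no_selection_set U p ->
    [/\ (cutS U <= cutA U p)%O, (cutA U p <= cutC U p)%O,
        (cutS U <= cutB U p)%O & (cutB U p <= cutC U p)%O].
  move=> nosel; rewrite cutC_max // -(min_cutA_cutB nosel wR).
  by rewrite !ge_min !le_max !lexx !orbT.
have collapse p : no_selection_set U p -> rapid U ->
    [/\ cutS U = cutN U, cutA U p = cutN U, cutB U p = cutN U & cutC U p = cutN U].
  move=> nosel rap; have [SA AC SB BC] := order p nosel.
  have NS := le_cutN_cutS U; have CN := rapid_le_cutN nosel wR rap.
  have eqN X : (cutS U <= X)%O -> (X <= cutC U p)%O -> X = cutN U.
    by move=> SX XC; apply/le_anti; rewrite (le_trans XC CN) (le_trans NS SX).
  by split; apply: eqN => //; exact: le_trans AC.
have [p0 nosel0] := nonselective_partition wR nsel.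
split; [|split].
- move=> p nosel; split; last exact: order.
  by split; [exact: min_cutA_cutB|exact: cutA_cutE|exact: cutB_cutF|exact: cutC_max].
- split=> [rap|]; last exact: cutN_rapid nosel0 wR.
  by rewrite -(cutB_cutF nosel0 wR); have [] := collapse p0 nosel0 rap.
- move=> rap; have [S0 A0 B0 _] := collapse p0 nosel0 rap.
  split=> //.
  + by rewrite -(cutA_cutE nosel0 wR).
  + by rewrite -(cutB_cutF nosel0 wR).
  + by move=> p nosel; have [] := collapse p nosel rap.
Qed.
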